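(* Let $R$ be a ring and let $M$ be a left $R$-module such that $G(M)$ is infinite and $\omega(M)<\infty$. Then $\omega^c(M)=\chi^c(M)$.
   Context: Rings are associative with unity and modules are unitary left modules. A nontrivial submodule of $M$ is a submodule different from $0$ and $M$. The intersection graph $G(M)$ is the simple graph whose vertices are the nontrivial submodules of $M$, two distinct vertices being adjacent iff their intersection is nonzero; it is infinite if its vertex set is. The complement graph $G^c(M)$ has the same vertices, two distinct vertices being adjacent iff their intersection is zero. $\omega(M)$ and $\omega^c(M)$ are the clique numbers of $G(M)$ and $G^c(M)$, where the clique number is the supremum of the cardinalities of cliques (sets of pairwise adjacent vertices). $\chi^c(M)$ is the chromatic number of $G^c(M)$: the least cardinality of a set of colors admitting a coloring of the vertices in which adjacent vertices get different colors. *)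

(* Defs.v *)
From mathcomp Require Import all_boot all_algebra.
From mathcomp Require Import boolp classical_sets functions cardinality.
Set Implicit Arguments.
Unset Strict Implicit.
Unset Printing Implicit Defensive.
Import GRing.Theory.
Local Open Scope classical_set_scope.
Local Open Scope card_scope.

(* Cardinal numbers are represented by sets over arbitrary types, compared with
   [#<=] and identified up to [#=]. Every nonempty family of cardinals has a
   least element (proof: Zorn's lemma on partial systems of representatives that
   are injective in each coordinate), so suprema and minima exist. *)

Lemma card_le_minimum (V : Type) (P : set (set V)) : P !=set0 ->
  exists2 K, P K & forall X, P X -> K #<= X.
Proof.
move=> [X0 PX0].
pose Q (S : set (set V -> V)) :=
  (forall f X, S f -> P X -> X (f X)) /\
  (forall f g X, S f -> S g -> P X -> f X = g X -> f = g).
have [|S [[S1 S2] Smax]] := @Zorn_bigcup _ Q.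
  move=> F FQ Ftot; split.
    by move=> f X [S FS Sf]; have [+ _] := FQ _ FS; apply.
  move=> f g X [S FS Sf] [S' FS' Sg]; have [_ SQ] := FQ _ FS.
  have [_ SQ'] := FQ _ FS'.
  case: (Ftot _ _ FS FS') => sub; first exact: SQ' (sub _ Sf) Sg.
  exact: SQ Sf (sub _ Sg).
have [K [PK Ksurj]] :
    exists K, P K /\ forall x, K x -> exists2 f, S f & f K = x.
  apply: contrapT => noK.
  have ex X : exists x, P X -> X x /\ forall f, S f -> f X <> x.
    have [PX|nPX] := pselect (P X); last first.
      have [x _] : exists x : V, True.
        apply: contrapT => nx; apply: noK; exists X0; split=> // x.
        by case: nx; exists x.
      by exists x.
    apply: contrapT => nx; apply: noK; exists X; split=> // x Xx.
    apply: contrapT => nf; apply: nx; exists x => _; split=> // f Sf fx.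
    by apply: nf; exists f.
  have [h hP] := choice ex.
  apply: (Smax (S `|` [set h])).
    split; first by move=> f; left.
    move=> sub; have Sh : S h by apply: sub; right.
    by have [_ /(_ h Sh)] := hP X0 PX0.
  split.
    by move=> f X [Sf|->] PX; [exact: (S1 f X)|have [] := hP X PX].
  move=> f g X [Sf|->] [Sg|->] PX //; first exact: S2.
    by have [_ /(_ f Sf)] := hP X PX.
  by have [_ /(_ g Sg) + /esym] := hP X PX.
exists K => // X PX.
have KS : K #<= S.
  have -> : K = (fun f : set V -> V => f K) @` S; last exact: card_image_le.
  by apply/seteqP; split=> [x /Ksurj [f Sf <-]|x [f Sf <-]];
    [exists f|exact: (S1 f K)].
apply: card_le_trans KS _.
rewrite -(card_le_eql (A := (fun f : set V -> V => f X) @` S)).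
  by apply: subset_card_le => x [f Sf <-]; exact: (S1 f X).
by apply: inj_card_eq => f g /set_mem Sf /set_mem Sg; exact: S2.
Qed.

Lemma card_le_or (T U : Type) (A : set T) (B : set U) : A #<= B \/ B #<= A.
Proof.
have eA : @inl T U @` A #= A by apply: inj_card_eq => x y _ _ [].
have eB : @inr T U @` B #= B by apply: inj_card_eq => x y _ _ [].
have [|K PK Kmin] :=
    @card_le_minimum (T + U)%type [set inl @` A; inr @` B].
  by exists (inl @` A); left.
have KA : K #<= A by rewrite -(card_le_eqr eA); apply: Kmin; left.
have KB : K #<= B by rewrite -(card_le_eqr eB); apply: Kmin; right.
case: PK => KE; move: KA KB; rewrite KE.
  by rewrite [_ #<= B](card_le_eql eA) => _; left.
by rewrite [_ #<= A](card_le_eql eB) => BA _; right.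
Qed.

Lemma card_le_inj (T V : Type) (X : set T) : X #<= [set: V] ->
  exists h : X -> V, injective h.
Proof.
move=> /card_leP [f]; exists (fun x => val (f x)) => x y /val_inj.
by apply: inj; rewrite in_setT.
Qed.

Record sgraph := SGraph {
  vertex :> Type;
  adj : vertex -> vertex -> Prop;
  adj_sym : forall u v, adj u v -> adj v u;
  adj_irr : forall u, ~ adj u u }.

Definition infinite_graph (G : sgraph) := infinite_set [set: G].

Definition clique (G : sgraph) (C : set G) :=
  forall u v, C u -> C v -> u <> v -> adj u v.

Definition colorable (G : sgraph) (T : Type) (C : set T) :=
  exists f : G -> T,
    (forall u, C (f u)) /\ (forall u v, adj u v -> f u <> f v).

(* [K] is the supremum, i.e. the least upper bound among all cardinals, of the
   cardinalities of cliques; it need not be attained. *)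
Definition is_clique_number (G : sgraph) (U : Type) (K : set U) :=
  (forall C : set G, clique C -> C #<= K) /\
  (forall (T : Type) (X : set T),
    (forall C : set G, clique C -> C #<= X) -> K #<= X).

Definition is_chromatic_number (G : sgraph) (U : Type) (K : set U) :=
  colorable G K /\ (forall (T : Type) (C : set T), colorable G C -> K #<= C).

Lemma ex_clique_number (G : sgraph) :
  exists K : set G, is_clique_number G K.
Proof.
have [|K PK Kmin] := @card_le_minimum G
    [set X | forall C : set G, clique C -> C #<= X].
  by exists setT => C _; exact: card_leT.
exists K; split=> // T X XP.
have [GX|XG] := card_le_or [set: G] X.
  exact: card_le_trans (card_leT K) GX.
have [h hI] := card_le_inj XG.
have eX : range h #= X.
  by apply: card_eq_trans (card_setT X); apply: inj_card_eq => x y _ _ /hI.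
rewrite -(card_le_eqr eX); apply: Kmin => C cC.
by rewrite (card_le_eqr eX); exact: XP.
Qed.

Lemma ex_chromatic_number (G : sgraph) :
  exists K : set G, is_chromatic_number G K.
Proof.
have [|K PK Kmin] := @card_le_minimum G [set X | colorable G X].
  by exists setT, id; split=> // u v uv E; move: uv; rewrite E; exact: adj_irr.
exists K; split=> // T C [f [fC fP]].
have [h hI] := card_le_inj (card_image_le f [set: G]).
have eX : range h #= range f.
  by apply: card_eq_trans (card_setT _); apply: inj_card_eq => x y _ _ /hI.
have fC' : range f `<=` C by move=> _ [u _ <-].
apply: card_le_trans (subset_card_le fC').
rewrite -(card_le_eqr eX); apply: Kmin.
have imf u : f u \in range f by apply/mem_set; exists u.
exists (fun u => h (SigSub (imf u))); split.
  by move=> u; exists (SigSub (imf u)).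
by move=> u v uv /hI /(congr1 val) /=; exact: fP.
Qed.

(* Both numbers are determined up to [#=] by the two specification lemmas. *)
Definition clique_number (G : sgraph) : set G :=
  sval (cid (ex_clique_number G)).
Arguments clique_number : clear implicits.

Lemma clique_numberP (G : sgraph) : is_clique_number G (clique_number G).
Proof. by rewrite /clique_number; case: cid. Qed.

Definition chromatic_number (G : sgraph) : set G :=
  sval (cid (ex_chromatic_number G)).
Arguments chromatic_number : clear implicits.

Lemma chromatic_numberP (G : sgraph) :
  is_chromatic_number G (chromatic_number G).
Proof. by rewrite /chromatic_number; case: cid. Qed.

Section IntersectionGraph.
Variables (R : pzRingType) (M : lmodType R).

Definition nontrivial_submodule (N : set M) :=
  [/\ submod_closed [in N], N <> [set 0%R] & N <> setT].

Definition submodule_vertex := {N : set M | nontrivial_submodule N}.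

Definition meet_nonzero (u v : submodule_vertex) :=
  u <> v /\ sval u `&` sval v <> [set 0%R].

Definition meet_zero (u v : submodule_vertex) :=
  u <> v /\ sval u `&` sval v = [set 0%R].

Lemma meet_nonzero_sym u v : meet_nonzero u v -> meet_nonzero v u.
Proof. by move=> [uv I]; split; [exact: nesym|rewrite setIC]. Qed.

Lemma meet_zero_sym u v : meet_zero u v -> meet_zero v u.
Proof. by move=> [uv I]; split; [exact: nesym|rewrite setIC]. Qed.

Lemma meet_nonzero_irr u : ~ meet_nonzero u u.
Proof. by case. Qed.

Lemma meet_zero_irr u : ~ meet_zero u u.
Proof. by case. Qed.

Definition intersection_graph := SGraph meet_nonzero_sym meet_nonzero_irr.

Definition complement_graph := SGraph meet_zero_sym meet_zero_irr.

End IntersectionGraph.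

(* Main.v *)
Require Import Defs.
From mathcomp Require Import all_boot all_algebra.
From mathcomp Require Import boolp classical_sets functions cardinality.

(* If cliques of the intersection graph are of bounded finite size, there is no
   infinite strictly descending chain of nontrivial submodules, since such a
   chain would be an infinite clique. Hence every nontrivial submodule contains
   a minimal one. Distinct minimal submodules meet in zero, so they form a
   clique of the complement graph; and choosing a minimal submodule inside each
   vertex is a proper coloring of the complement graph, because two vertices
   with the same color have a nonzero intersection. *)

Set Implicit Arguments.
Unset Strict Implicit.
Unset Printing Implicit Defensive.
Import GRing.Theory.
Local Open Scope classical_set_scope.
Local Open Scope card_scope.

(** A proper coloring is injective on each clique, so any set of colors bounds all cliques, and
    hence their supremum. *)
Lemma clique_number_le_chromatic_number (G : sgraph) :
  clique_number G #<= chromatic_number G.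
Proof.
have [_ min_omega] := clique_numberP G.
have [[f [fK fP]] _] := chromatic_numberP G.
apply: min_omega => C cC.
have fC : f @` C #= C.
  apply: inj_card_eq => u v /set_mem Cu /set_mem Cv fuv.
  by apply: contrapT => /(cC _ _ Cu Cv)/fP; apply.
rewrite -(card_le_eql fC).
by apply: subset_card_le => _ [u _ <-].
Qed.

Section MinimalSubmodules.
Variables (R : pzRingType) (M : lmodType R).

Local Notation vert := (submodule_vertex M).

Definition minimal_vertex (u : vert) :=
  forall v : vert, sval v `<=` sval u -> v = u.

Lemma vertex_inj (u v : vert) : sval u = sval v -> u = v.
Proof. by case: u v => [A hA] [B hB] /= AB; exact: eq_exist. Qed.

Lemma submod_closedI (A B : set M) :
  submod_closed [in A] -> submod_closed [in B] -> submod_closed [in A `&` B].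
Proof.
move=> [A0 AD] [B0 BD]; split=> [|a x y].
  by apply/mem_set; split; apply/set_mem.
move=> /set_mem [Ax Bx] /set_mem [Ay By]; apply/mem_set.
by split; apply/set_mem; [apply: AD|apply: BD]; exact/mem_set.
Qed.

(** Otherwise the intersection is itself a vertex inside both, and minimality makes it equal to
    each. *)
Lemma minimal_vertex_meet_zero (u v : vert) :
  minimal_vertex u -> minimal_vertex v -> u <> v -> meet_zero u v.
Proof.
move=> umin vmin uv; split=> //; apply: contrapT => I0.
have [uS _ uT] := svalP u; have [vS _ _] := svalP v.
have wP : nontrivial_submodule (sval u `&` sval v).
  split=> //; first exact: submod_closedI.
  by rewrite -subTset => IT; apply: uT; rewrite -subTset => x /IT [].
pose w : vert := exist _ _ wP.
have wu : w = u by apply: umin => x [].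
have wv : w = v by apply: vmin => x [].
by apply: uv; rewrite -wu wv.
Qed.

Lemma sub_meet_nonzero (u v w : vert) :
  sval w `<=` sval u -> sval w `<=` sval v -> sval u `&` sval v <> [set 0%R].
Proof.
move=> wu wv I0; have [[w0 _] wN0 _] := svalP w; apply: wN0.
apply/seteqP; split=> [x wx|_ ->]; last exact/set_mem.
by rewrite -I0; split; [exact: wu|exact: wv].
Qed.

Lemma minimal_vertex_below :
  finite_set (clique_number (intersection_graph M)) ->
  forall u : vert, exists2 v, minimal_vertex v & sval v `<=` sval u.
Proof.
move=> finK u; apply: contrapT => nomin.
(* Outside the submodules of [u], the witness [v] is a dummy that makes the choice function
   total. *)
have below (v : vert) : exists w : vert,
    sval v `<=` sval u -> sval w `<=` sval v /\ w <> v.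
  have [vu|nvu] := pselect (sval v `<=` sval u); last by exists v.
  apply: contrapT => nw; apply: nomin; exists v => // w wv.
  by apply: contrapT => nwv; apply: nw; exists w.
have [s sP] := choice below.
pose c n := iter n s u.
have cu n : sval (c n) `<=` sval u.
  elim: n => [//|n IHn]; have [sub _] := sP _ IHn.
  exact: subset_trans sub IHn.
have cS n : sval (c n.+1) `<=` sval (c n) by have [] := sP _ (cu n).
have c_anti m n : (m <= n)%N -> sval (c n) `<=` sval (c m).
  move=> /subnK <-; elim: (n - m)%N => [//|k IHk].
  by apply: subset_trans IHk; rewrite addSn; exact: cS.
(* Equality would squeeze [c m.+1] between [c n] and [c m], against strict descent at [m]. *)
have c_neq m n : (m < n)%N -> c m <> c n.
  move=> mn cmn; have [_] := sP _ (cu m); apply; apply: vertex_inj.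
  apply/seteqP; split; first exact: cS.
  by rewrite {1}cmn; exact: (c_anti m.+1).
have c_inj : injective c.
  by move=> m n cmn; case: (ltngtP m n) => // /c_neq; rewrite cmn.
have c_clique : clique (G := intersection_graph M) (range c).
  move=> _ _ [m _ <-] [n _ <-] neq; split=> //.
  (* The later of the two terms lies in both. *)
  by apply: (@sub_meet_nonzero _ _ (c (maxn m n))); apply: c_anti;
    rewrite ?leq_maxl ?leq_maxr.
have [cK _] := clique_numberP (intersection_graph M).
apply: infinite_nat; rewrite -(@eq_finite_set _ _ (range c)).
  exact: card_le_finite (cK _ c_clique) finK.
by apply: inj_card_eq => m n _ _ /c_inj.
Qed.

Lemma minimal_vertex_colorable :
  finite_set (clique_number (intersection_graph M)) ->
  colorable (complement_graph M) minimal_vertex.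
Proof.
move=> finK.
have ex (u : vert) : exists v : vert,
    minimal_vertex v /\ sval v `<=` sval u.
  by have [v] := minimal_vertex_below finK u; exists v.
have [f fP] := choice ex; exists f; split=> [u|u v [_ I0] fuv].
  by have [] := fP u.
apply: (@sub_meet_nonzero u v (f u)) I0; first by have [] := fP u.
by rewrite fuv; have [] := fP v.
Qed.

End MinimalSubmodules.

Theorem corollary4p5 (R : pzRingType) (M : lmodType R) :
  infinite_graph (intersection_graph M) ->
  finite_set (clique_number (intersection_graph M)) ->
  (clique_number (complement_graph M) #= chromatic_number (complement_graph M))%card.
Proof.
move=> _ finK; rewrite card_eq_le clique_number_le_chromatic_number /=.
have [omega_ub _] := clique_numberP (complement_graph M).
have [_ chi_min] := chromatic_numberP (complement_graph M).
(* The set of minimal vertices separates the two numbers: it is a set of colors and also a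
   clique. *)
apply: card_le_trans (chi_min _ _ (minimal_vertex_colorable finK)) _.
by apply: omega_ub => u v; exact: minimal_vertex_meet_zero.
Qed.
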